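(* For $n\ge0$ let $G_n:\mathbb R^d\to(0,\infty)$ be $C^1$ with $0<\varepsilon<G_n(x)\le\overline G_n<\infty$ for all $x\in\mathbb R^d$, $\|G_n\|_{\mathrm{Lip}}<\infty$ and $\sup_z\|z\|\cdot\|\nabla G_n(z)\|\le\tilde G_n<\infty$. For $n\ge1$ let $M^{(n)}$ be a Markov kernel on $\mathbb R^d$ with $M^{(n)}(x,\cdot)\in\mathcal P_1(\mathbb R^d)$ for all $x$ and $\tau_1(M^{(n)})<\infty$, and let $\Phi_n[\eta]=\Psi_{G_{n-1}}(\eta)M^{(n)}$. Then for every $k\ge1$ and all $\mu,\nu\in\mathcal P_1(\mathbb R^d)$ $$\mathbf W_1(\Phi_k[\mu],\Phi_k[\nu])\le\tau_1(\Psi_{G_{k-1}})[\nu]\;\tau_1(M^{(k)})\;\mathbf W_1(\mu,\nu),$$ where $$\tau_1(\Psi_{G_n})[\nu]:=\frac{\|\nabla G_n\|_\infty+\tilde G_n+\overline G_n}{\varepsilon}+\frac{\|G_n\|_{\mathrm{Lip}}\,\overline G_n}{\varepsilon^2}\,\mathbf M_1(\nu).$$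
   Context: $\mathcal P_1(\mathbb R^d)$ is the set of Borel probability measures on $\mathbb R^d$ with finite first moment; $\mathbf M_1(\nu)=\int\|x\|\nu(dx)$; $\mathbf W_1$ is the 1-Wasserstein distance for the Euclidean norm; $\|G\|_{\mathrm{Lip}}$ is the best Lipschitz constant of $G$; $\Psi_G(\eta)(dx)=G(x)\eta(dx)/\eta(G)$ with $\eta(G)=\int G\,d\eta$ is the Boltzmann–Gibbs transformation; $\mu M(dy)=\int\mu(dx)M(x,dy)$; for a Markov kernel $M$, $\tau_1(M)=\sup_{\mu\ne\nu\in\mathcal P_1}\mathbf W_1(\mu M,\nu M)/\mathbf W_1(\mu,\nu)$. *)

(* Defs.v *)
From HB Require Import structures.
From mathcomp Require Import all_boot all_order all_algebra.
From mathcomp Require Import all_classical all_reals all_analysis.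
From mathcomp Require Import measurable_realfun giry.

Set Implicit Arguments.
Unset Strict Implicit.
Unset Printing Implicit Defensive.

Import Order.TTheory GRing.Theory Num.Theory.
Import numFieldNormedType.Exports.

Local Open Scope classical_set_scope.
Local Open Scope ring_scope.

(* R^d is 'rV[R]_d. Its library norm `|x| is the sup norm, which is used here
   only through the topology and the notion of differentiability it induces;
   all metric quantities below use the Euclidean norm enorm. *)

Definition borel_mx_display : measure_display.
Proof. by constructor. Qed.

Section borel_mx.
Context (R : realType) (m n : nat).

Definition borel_mx : set (set 'M[R]_(m, n)) := <<s @open 'M[R]_(m, n) >>.

Fact borel_mx0 : borel_mx set0.
Proof. exact: sigma_algebra0. Qed.

Fact borel_mxC (A : set 'M[R]_(m, n)) : borel_mx A -> borel_mx (~` A).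
Proof. exact: sigma_algebraC. Qed.

Fact borel_mxU (F : (set 'M[R]_(m, n))^nat) :
  (forall i, borel_mx (F i)) -> borel_mx (\bigcup_i F i).
Proof. exact: sigma_algebra_bigcup. Qed.

HB.instance Definition _ := @isMeasurable.Build borel_mx_display
  'M[R]_(m, n) borel_mx borel_mx0 borel_mxC borel_mxU.

End borel_mx.

Section euclidean.
Context (R : realType) (d : nat).
Implicit Types (x y : 'rV[R]_d) (G : 'rV[R]_d -> R).

Definition enorm x : R := Num.sqrt (\sum_(i < d) x ord0 i ^+ 2).

Definition grad G x : 'rV[R]_d := \row_(i < d) 'D_(delta_mx ord0 i) G x.

Definition C1 G : Prop :=
  (forall x, differentiable G x) /\ continuous (grad G).

(* Best Lipschitz constant; it is +oo when G is not Lipschitz. *)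
Definition lip_norm G : \bar R :=
  ereal_inf [set L%:E | L in
    [set L : R | 0 <= L /\ forall x y, `|G x - G y| <= L * enorm (x - y)]].

Definition grad_sup G : \bar R :=
  ereal_sup [set (enorm (grad G x))%:E | x in setT].

Lemma C1_measurable G : C1 G -> measurable_fun setT G.
Proof.
move=> [dG _].
have cG : continuous G by move=> x; exact/differentiable_continuous/dG.
apply: (measurability _ (RGenOInfty.measurableE R)) => _ [_ [a ->] <-].
rewrite setTI; apply: sub_sigma_algebra.
by move/continuousP: cG; apply; exact: interval_open.
Qed.

End euclidean.

Local Open Scope ereal_scope.

Section wasserstein.
Context (R : realType) (d : nat).
Implicit Types mu nu : probability 'rV[R]_d R.

Definition M1 mu : \bar R := \int[mu]_x (enorm x)%:E.

Definition P1 : set (probability 'rV[R]_d R) := [set mu | M1 mu < +oo].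

Definition couplings mu nu : set (probability ('rV[R]_d * 'rV[R]_d)%type R) :=
  [set pi | (forall A, measurable A -> pi (A `*` setT) = mu A) /\
            (forall B, measurable B -> pi (setT `*` B) = nu B)].

Definition W1 mu nu : \bar R :=
  ereal_inf [set \int[pi]_z (enorm (z.1 - z.2))%:E | pi in couplings mu nu].

End wasserstein.

Section markov.
Context d1 d2 (X : measurableType d1) (Y : measurableType d2) (R : realType).
Variables (mu : probability X R) (M : R.-pker X ~> Y).

Definition kact (A : set Y) : \bar R := \int[mu]_x M x A.

Let kact0 : kact set0 = 0.
Proof. by rewrite /kact integral0_eq// => x _; rewrite measure0. Qed.

Let kact_ge0 A : 0 <= kact A.
Proof. exact: integral_ge0. Qed.

Let kact_sigma_additive : semi_sigma_additive kact.
Proof.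
move=> U mU tU mUU; rewrite [X in _ --> X](_ : _ =
  \int[mu]_x (\sum_(n <oo) M x (U n))); last first.
  apply: eq_integral => x _.
  by apply/esym/cvg_lim => //; exact/measure_semi_sigma_additive.
apply/cvg_closeP; split.
  by apply: is_cvg_nneseries => n _ _; exact: integral_ge0.
rewrite closeE// integral_nneseries// => n.
exact: measurable_kernel.
Qed.

HB.instance Definition _ :=
  isMeasure.Build _ _ R kact kact0 kact_ge0 kact_sigma_additive.

Let kact1 : kact setT = 1.
Proof.
rewrite /kact (eq_integral (cst 1)); last by move=> x _; rewrite prob_kernel.
by rewrite integral_cst// mul1e; exact: probability_setT.
Qed.

HB.instance Definition _ := Measure_isProbability.Build _ _ R kact kact1.

End markov.

Section boltzmann_gibbs.
Context d (X : measurableType d) (R : realType).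
Implicit Types (G : X -> R) (eta : probability X R).

(* The probability measure A |-> eta(1_A G) / eta(G). It exists (lemma
   boltzmann_gibbsE) as soon as G is measurable, positive and bounded, and its
   values on measurable sets are then unique. *)
Definition boltzmann_gibbs G eta : probability X R :=
  get [set P : probability X R | forall A, measurable A ->
    P A = (\int[eta]_(x in A) (G x)%:E) / (\int[eta]_x (G x)%:E)].

Section existence.
Variables (G : X -> R) (eta : probability X R) (e c : R).
Hypotheses (mG : measurable_fun setT G) (e0 : (0 < e)%R)
  (eG : forall x, (e <= G x)%R) (Gc : forall x, (G x <= c)%R).

Let etaT : eta setT = 1.
Proof. exact: probability_setT. Qed.

Let G0 x : (0 <= G x)%R.
Proof. exact: le_trans (ltW e0) (eG x). Qed.

Let gibbs (A : set X) : \bar R :=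
  (\int[eta]_(x in A) (G x)%:E) / (\int[eta]_x (G x)%:E).

Let mEG A : measurable_fun A (EFin \o G).
Proof.
by apply: (@measurable_funS _ _ _ _ setT) => //; exact/measurable_EFinP.
Qed.

Let Z_ge : e%:E <= \int[eta]_x (G x)%:E.
Proof.
have -> : e%:E = \int[eta]_x (cst e%:E) x.
  by rewrite integral_cst// [X in _ * X]etaT mule1.
apply: ge0_le_integral => //; first by move=> x _; rewrite lee_fin ltW.
by move=> x _; rewrite lee_fin.
Qed.

Let Z_le : \int[eta]_x (G x)%:E <= c%:E.
Proof.
have -> : c%:E = \int[eta]_x (cst c%:E) x.
  by rewrite integral_cst// [X in _ * X]etaT mule1.
apply: ge0_le_integral => //; first by move=> x _; rewrite lee_fin.
by move=> x _; rewrite lee_fin.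
Qed.

Let Z_fin : \int[eta]_x (G x)%:E \is a fin_num.
Proof.
rewrite ge0_fin_numE ?(le_lt_trans Z_le) ?ltry//.
by apply: integral_ge0 => x _; rewrite lee_fin.
Qed.

Let Z_gt0 : 0 < \int[eta]_x (G x)%:E.
Proof. by rewrite (lt_le_trans _ Z_ge)// lte_fin. Qed.

Let gibbs0 : gibbs set0 = 0.
Proof. by rewrite /gibbs integral_set0 mul0e. Qed.

Let gibbs_ge0 A : 0 <= gibbs A.
Proof.
apply: mule_ge0; first by apply: integral_ge0 => x _; rewrite lee_fin.
by rewrite inve_ge0 ltW.
Qed.

Let gibbs_sigma_additive : semi_sigma_additive gibbs.
Proof.
move=> F mF tF mUF; rewrite /gibbs ge0_integral_bigcup//; last first.
  by move=> x _; rewrite lee_fin.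
have iF0 i : 0 <= \int[eta]_(x in F i) (G x)%:E.
  by apply: integral_ge0 => x _; rewrite lee_fin.
under eq_fun do rewrite -ge0_sume_distrl//.
rewrite -(fineK Z_fin) inver gt_eqF; last first.
  by rewrite fine_gt0// Z_gt0 ltey_eq Z_fin.
by apply: cvgeZr => //; exact: is_cvg_nneseries.
Qed.

HB.instance Definition _ :=
  isMeasure.Build _ _ R gibbs gibbs0 gibbs_ge0 gibbs_sigma_additive.

Let gibbsT : gibbs setT = 1.
Proof. by rewrite /gibbs divee// gt_eqF. Qed.

HB.instance Definition _ := Measure_isProbability.Build _ _ R gibbs gibbsT.

Lemma boltzmann_gibbsE A : measurable A -> boltzmann_gibbs G eta A =
  (\int[eta]_(x in A) (G x)%:E) / (\int[eta]_x (G x)%:E).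
Proof.
apply: (@getPex _ [set P : probability X R | forall A, measurable A ->
  P A = (\int[eta]_(x in A) (G x)%:E) / (\int[eta]_x (G x)%:E)]).
by exists (gibbs : probability X R).
Qed.

End existence.

End boltzmann_gibbs.

Section contraction.
Context (R : realType) (d : nat).
Implicit Types (M : R.-pker 'rV[R]_d ~> 'rV[R]_d) (G : 'rV[R]_d -> R).

(* Distinctness of mu and nu is that of their values on Borel sets: Leibniz
   equality would also compare the values of the library's set functions on
   non-measurable sets. *)
Definition tau1 M : \bar R :=
  ereal_sup [set r | exists mu nu : probability 'rV[R]_d R,
    [/\ P1 mu, P1 nu, ~ measure_eq mu nu &
        r = W1 (kact mu M) (kact nu M) / W1 mu nu]].

Definition tau1_gibbs (eps Gbar Gtil : R) G (nu : probability 'rV[R]_d R)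
    : \bar R :=
  (grad_sup G + Gtil%:E + Gbar%:E) / eps%:E
  + lip_norm G * Gbar%:E / (eps ^+ 2)%:E * M1 nu.

Definition Phi (G : nat -> 'rV[R]_d -> R)
    (M : nat -> R.-pker 'rV[R]_d ~> 'rV[R]_d) (n : nat)
    (eta : probability 'rV[R]_d R) : probability 'rV[R]_d R :=
  kact (boltzmann_gibbs (G n.-1) eta) (M n).

End contraction.

(* Main.v *)
(* Given a coupling pi of mu and nu, put a = mu(G) and b = nu(G). Keep the part
   min(G x / a, G y / b) of pi coupled as it is and couple the two remainders
   independently; through the origin this costs at most
     int |x-y| min(G x/a, G y/b) + |x| (G x/a - G y/b)^+ + |y| (G y/b - G x/a)^+
   with respect to pi. The integrand is at most
     (Gtil + Gbar) |x-y| / a + Gbar |y| |1/b - 1/a|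
   by the mean value theorem, and |a - b| <= Lip(G) int |x-y| dpi, so that the
   Boltzmann-Gibbs map has the claimed Lipschitz constant; the Markov kernel
   contributes tau1 by definition. *)
Require Import Defs.
From HB Require Import structures.
From mathcomp Require Import all_boot all_order all_algebra.
From mathcomp Require Import all_classical all_reals all_analysis.
From mathcomp Require Import measurable_realfun giry.
From mathcomp Require Import ring lra.
Import Order.TTheory GRing.Theory Num.Theory.
Import numFieldNormedType.Exports.
Local Open Scope classical_set_scope.
Local Open Scope ring_scope.
Local Open Scope ereal_scope.

(** * The Euclidean norm, gradients and the pointwise transport bound *)

Section euclidean_norm.
Local Open Scope ring_scope.
Context {R : realType} {d : nat}.
Implicit Types (x y z u : 'rV[R]_d) (G : 'rV[R]_d -> R).

Lemma enorm_ge0 x : 0 <= enorm x.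
Proof. exact: sqrtr_ge0. Qed.

Lemma sqr_enorm x : enorm x ^+ 2 = \sum_(i < d) x ord0 i ^+ 2.
Proof. by rewrite sqr_sqrtr// sumr_ge0// => i _; rewrite sqr_ge0. Qed.

Lemma enorm0 : enorm (0 : 'rV[R]_d) = 0.
Proof.
by rewrite /enorm big1 ?sqrtr0// => i _; rewrite mxE expr0n.
Qed.

Lemma enorm_eq0 x i : enorm x = 0 -> x ord0 i = 0.
Proof.
move=> x0; have := sqr_enorm x; rewrite x0 expr0n/= => /esym/eqP.
rewrite psumr_eq0; last by move=> j _; rewrite sqr_ge0.
by move=> /allP/(_ i (mem_index_enum _)); rewrite /= sqrf_eq0 => /eqP.
Qed.

Lemma enormZ (k : R) x : enorm (k *: x) = `|k| * enorm x.
Proof.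
rewrite /enorm (eq_bigr (fun i => k ^+ 2 * x ord0 i ^+ 2)); last first.
  by move=> i _; rewrite mxE exprMn.
by rewrite -mulr_sumr sqrtrM ?sqr_ge0// sqrtr_sqr.
Qed.

Lemma enormN x : enorm (- x) = enorm x.
Proof. by rewrite -scaleN1r enormZ normrN normr1 mul1r. Qed.

Lemma enorm_distC x y : enorm (x - y) = enorm (y - x).
Proof. by rewrite -enormN opprB. Qed.

(** Cauchy-Schwarz: the squares of [enorm y * x_i - enorm x * y_i] sum to 2|x||y|(|x||y| - <x,y>).
    If one norm vanishes, so do all coordinates of that vector. *)
Lemma dot_le_enorm x y :
  \sum_(i < d) x ord0 i * y ord0 i <= enorm x * enorm y.
Proof.
have [x0|x0] := eqVneq (enorm x) 0.
  by rewrite x0 mul0r big1// => i _; rewrite enorm_eq0 ?mul0r.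
have [y0|y0] := eqVneq (enorm y) 0.
  by rewrite y0 mulr0 big1// => i _; rewrite (enorm_eq0 y) ?mulr0.
have xy0 : 0 < enorm x * enorm y.
  by rewrite mulr_gt0// lt_neqAle enorm_ge0 eq_sym ?x0 ?y0.
rewrite -(ler_pM2l xy0) mulr_sumr -subr_ge0.
suff : 0 <= \sum_(i < d) (enorm y * x ord0 i - enorm x * y ord0 i) ^+ 2.
  rewrite (eq_bigr (fun i => (enorm y ^+ 2 * x ord0 i ^+ 2
      + enorm x ^+ 2 * y ord0 i ^+ 2)
      - 2 * (enorm x * enorm y * (x ord0 i * y ord0 i)))); last first.
    by move=> i _; ring.
  rewrite big_split big_split/= -!mulr_sumr -!sqr_enorm sumrN -!mulr_sumr.
  by lra.
by apply: sumr_ge0 => i _; rewrite sqr_ge0.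
Qed.

Lemma abs_dot_le_enorm x y :
  `|\sum_(i < d) x ord0 i * y ord0 i| <= enorm x * enorm y.
Proof.
rewrite ler_norml dot_le_enorm andbT lerNl -sumrN -(enormN x).
rewrite (eq_bigr (fun i => (- x) ord0 i * y ord0 i)) ?dot_le_enorm// => i _.
by rewrite mxE mulNr.
Qed.

Lemma ler_enormD x y : enorm (x + y) <= enorm x + enorm y.
Proof.
rewrite -ler_sqr ?nnegrE ?addr_ge0 ?enorm_ge0// sqr_enorm.
rewrite (eq_bigr (fun i => (x ord0 i ^+ 2 + y ord0 i ^+ 2)
    + 2 * (x ord0 i * y ord0 i))); last by move=> i _; rewrite mxE; ring.
rewrite !big_split/= -mulr_sumr -!sqr_enorm.
by have := dot_le_enorm x y; rewrite sqrrD; lra.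
Qed.

Lemma ler_enormB x y : enorm (x - y) <= enorm x + enorm y.
Proof. by rewrite -(enormN y) ler_enormD. Qed.

(** Asking for measurable coordinates makes this apply to [z.1 - z.2] on [E * E], which carries the
    product sigma-algebra. *)
Lemma measurable_enorm {disp} {T : measurableType disp} (f : T -> 'rV[R]_d) :
  (forall i, measurable_fun setT (fun t => f t ord0 i)) ->
  measurable_fun setT (fun t => enorm (f t)).
Proof.
move=> mf; have msqrt : measurable_fun setT (@Num.sqrt R).
  by apply: continuous_measurable_fun; exact: sqrt_continuous.
rewrite /enorm; apply: (measurableT_comp msqrt).
by apply: measurable_sum => i; exact: measurable_funX.
Qed.

Lemma measurable_coord i : measurable_fun setT (fun x : 'rV[R]_d => x ord0 i).
Proof.
apply: (measurability _ (RGenOInfty.measurableE R)) => _ [_ [a ->] <-].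
rewrite setTI; apply: sub_sigma_algebra.
have /continuousP := @coord_continuous R 1 d ord0 i.
by apply; exact: interval_open.
Qed.

Lemma derive_dot_grad G x u : differentiable G x ->
  'D_u G x = \sum_(i < d) u ord0 i * grad G x ord0 i.
Proof.
move=> dG; rewrite deriveE// {1}(row_sum_delta u) linear_sum/=.
by apply: eq_bigr => i _; rewrite linearZ/= mxE deriveE.
Qed.

Lemma abs_derive_le G x u : differentiable G x ->
  `|'D_u G x| <= enorm u * enorm (grad G x).
Proof. by move=> dG; rewrite derive_dot_grad// abs_dot_le_enorm. Qed.

(* The left-hand side is |x| G x - f y G y for the 1-Lipschitz function
   f z = |x| - |x - z|, whose absolute value is at most |z|: hence the bound
   by the supremum of |G| + |z| |grad G z|. On the segment from x to y, f is
   affine, so that the mean value theorem applies to f G. *)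
Lemma lipschitz_weight G (A B : R) x y : C1 G ->
  (forall z, 0 <= G z <= A) -> (forall z, enorm z * enorm (grad G z) <= B) ->
  enorm x * (G x - G y) + enorm (x - y) * G y <= (B + A) * enorm (x - y).
Proof.
move=> [dG _] GA GB.
pose z t : 'rV[R]_d := x + t *: (y - x).
pose f (t : R) : R := enorm x - t * enorm (x - y).
have z_le (t : R) : 0 <= t -> `|f t| <= enorm (z t).
  move=> t0; have e : t * enorm (x - y) = enorm (z t - x).
    by rewrite /z addrAC subrr add0r enormZ ger0_norm// enorm_distC.
  rewrite /f e enorm_distC; apply/ler_normlP; split.
    by have := ler_enormB x (z t); lra.
  by have := ler_enormD (z t) (x - z t); rewrite addrC subrK; lra.
have df (t : R) : is_derive t (1 : R) f (- enorm (x - y)).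
  rewrite /f; apply: is_derive_eq.
  by rewrite add0r mul1r scaler0 add0r [_%:A]mulr1.
(* Chain rule by hand: the difference quotient of [G \o z] at [t] along 1 is that of [G] at [z t]
   along [y - x]. *)
have dGz (t : R) : is_derive t (1 : R) (G \o z) ('D_(y - x) G (z t)).
  have e : (fun h => h^-1 *: ((G \o z \o shift t) (h *: 1) - (G \o z) t)) =
           (fun h => h^-1 *: ((G \o shift (z t)) (h *: (y - x)) - G (z t))).
    apply/funext => h /=; congr (_ *: (G _ - _)).
    by rewrite /z [h%:A]mulr1 scalerDl addrCA.
  by split; [rewrite /derivable e; exact: diff_derivable|rewrite /derive e].
have dp (t : R) : is_derive t (1 : R) (f * (G \o z))
    (f t * 'D_(y - x) G (z t) - G (z t) * enorm (x - y)).
  by apply: is_derive_eq; rewrite /GRing.scale/= mulrN.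
have [|t /[!in_itv]/= /andP[t0 t1]] := MVT_segment ler01 (fun t _ => dp t).
  apply: continuous_subspaceT => t.
  by apply/differentiable_continuous/derivable1_diffP; have [] := dp t.
(* The endpoint values are |x| G x at 0 and (|x| - |x-y|) G y at 1, so the increment is minus the
   left-hand side of the goal. *)
rewrite subr0 mulr1 /= !fctE /f /z/= mul0r mul1r scale0r scale1r addr0 subr0.
rewrite [x + (y - x)]addrC subrK -/(f t) -/(z t) => e.
have Gz0 : 0 <= G (z t) by have /andP[] := GA (z t).
have D_le := abs_derive_le _ (z t) (y - x) (dG _).
have fD_le : `|f t * 'D_(y - x) G (z t)| <= B * enorm (x - y).
  rewrite normrM (le_trans (ler_pM _ _ (z_le t t0) D_le))//.
  by rewrite mulrCA mulrC enorm_distC ler_wpM2r ?enorm_ge0 ?GB.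
have GzA : G (z t) * enorm (x - y) <= A * enorm (x - y).
  by rewrite ler_wpM2r ?enorm_ge0//; have /andP[] := GA (z t).
have := ler_norml (f t * 'D_(y - x) G (z t)) (B * enorm (x - y)).
rewrite fD_le => /esym/andP[fD1 fD2].
lra.
Qed.


(** [a] and [b] stand for the inverses of the two normalising constants. Replacing [b] by [a] leads
    to [a] times [lipschitz_weight], with an error [(b - a) * G y * s] where |s| <= |y|. As the
    error is controlled by |y| alone, only the first moment of the second measure enters the final
    constant. *)
Lemma transport_weight G (A B : R) x y (a b : R) : C1 G ->
  (forall z, 0 <= G z <= A) -> (forall z, enorm z * enorm (grad G z) <= B) ->
  0 <= a ->
  enorm (x - y) * Num.min (a * G x) (b * G y)
    + enorm x * Num.max 0 (a * G x - b * G y)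
    + enorm y * Num.max 0 (b * G y - a * G x)
  <= (B + A) * a * enorm (x - y) + A * `|b - a| * enorm y.
Proof.
move=> cG GA GB a0.
have yba (s : R) : `|s| <= enorm y ->
    s * G y * (b - a) <= A * `|b - a| * enorm y.
  move=> sy; apply: le_trans (ler_norm _) _.
  have /andP[Gy0 GyA] := GA y.
  rewrite !normrM (ger0_norm Gy0) mulrAC [leRHS]mulrC mulrA.
  rewrite [leRHS]mulrAC; apply: ler_pM => //.
  by apply: ler_pM.
have [le_xy|lt_xy] := leP (b * G y) (a * G x).
  have -> : Num.max 0 (a * G x - b * G y) = a * G x - b * G y.
    by apply/max_idPr; lra.
  have -> : Num.max 0 (b * G y - a * G x) = 0 by apply/max_idPl; lra.
  have h := lipschitz_weight _ _ _ x y cG GA GB.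
  have := ler_wpM2l a0 h.
  (* In this case s = |x-y| - |x|. *)
  have := yba (enorm (x - y) - enorm x).
  suff dy : `|enorm (x - y) - enorm x| <= enorm y by move=> /(_ dy); lra.
  have := ler_enormB x y; have := ler_enormD (x - y) y; rewrite subrK.
  by move=> xy1 xy2; apply/ler_normlP; split; lra.
have -> : Num.max 0 (a * G x - b * G y) = 0 by apply/max_idPl; lra.
have -> : Num.max 0 (b * G y - a * G x) = b * G y - a * G x.
  by apply/max_idPr; lra.
(* Now [x] and [y] exchange roles, and s = |y|. *)
have h := lipschitz_weight _ _ _ y x cG GA GB.
have := ler_wpM2l a0 h; rewrite enorm_distC.
have := yba (enorm y); rewrite ger0_norm ?enorm_ge0// lexx => /(_ isT).
by lra.
Qed.

End euclidean_norm.

(** * Measures with a density, and integrals of products *)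

Section density.
Context {disp} {T : measurableType disp} {R : realType}.
Variables (m : {measure set T -> \bar R}) (w : T -> R).
Hypotheses (mw : measurable_fun setT w) (w_ge0 : forall x, (0 <= w x)%R).

Definition mdensity_fun (A : set T) : \bar R := \int[m]_(x in A) (w x)%:E.

Let mdensity0 : mdensity_fun set0 = 0.
Proof. by rewrite /mdensity_fun integral_set0. Qed.

Let mdensity_ge0 A : 0 <= mdensity_fun A.
Proof. by apply: integral_ge0 => x _; rewrite lee_fin. Qed.

Let mdensity_sigma_additive : semi_sigma_additive mdensity_fun.
Proof.
move=> F mF tF mUF; rewrite /mdensity_fun ge0_integral_bigcup//.
- by apply: is_cvg_nneseries => n _ _; exact: mdensity_ge0.
- exact/measurable_funTS/measurable_EFinP.
- by move=> x _; rewrite lee_fin.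
Qed.

HB.instance Definition _ := isMeasure.Build _ _ R mdensity_fun
  mdensity0 mdensity_ge0 mdensity_sigma_additive.

Definition mdensity : {measure set T -> \bar R} := mdensity_fun.

Import HBNNSimple.

Let integral_mdensity_nnsfun (f : {nnsfun T >-> R}) :
  \int[mdensity]_x (f x)%:E = \int[m]_x ((f x)%:E * (w x)%:E).
Proof.
(* A simple function is the sum of its weighted level-set indicators, for which the identity is the
   definition of the density measure. *)
transitivity (\sum_(k \in range f)
    \int[m]_x ((k * \1_(f @^-1` [set k]) x)%:E * (w x)%:E)).
  under eq_integral do rewrite fimfunE -fsumEFin//.
  rewrite ge0_integral_fsum//; last 2 first.
  - by move=> r; exact/measurable_EFinP/measurable_funM.
  - by move=> r x _; rewrite EFinM nnfun_muleindic_ge0.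
  apply: eq_fsbigr => r; rewrite inE => -[t _ <-{r}].
  rewrite integralZl_indic_nnsfun// integral_indic//= setIT.
  rewrite /mdensity_fun integral_mkcond -ge0_integralZl//.
  - apply: eq_integral => x _; rewrite /patch indicE.
    by case: ifP => _; rewrite ?mulr1 ?mulr0 ?mul0e ?mule0.
  - apply/(measurable_restrict _ _ _).1 => //.
    exact/measurable_funTS/measurable_EFinP.
  - by move=> x _; rewrite /patch; case: ifP => _; rewrite // lee_fin.
  - by rewrite lee_fin.
rewrite -ge0_integral_fsum//; last 2 first.
- move=> r; apply: emeasurable_funM; last exact/measurable_EFinP.
  exact/measurable_EFinP/measurable_funM.
- move=> r x _; rewrite mule_ge0 ?lee_fin//.
  by rewrite -lee_fin EFinM nnfun_muleindic_ge0.
apply: eq_integral => x _.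
rewrite fimfunE -fsumEFin// ge0_mule_fsuml// => r.
by rewrite EFinM nnfun_muleindic_ge0.
Qed.

(** Both sides are limits along the simple approximations of [f], by monotone convergence under each
    measure; the simple case is already known. *)
Lemma integral_mdensity (f : T -> \bar R) : measurable_fun setT f ->
  (forall x, 0 <= f x) -> \int[mdensity]_x f x = \int[m]_x (f x * (w x)%:E).
Proof.
move=> mf f0; pose f_ := nnsfun_approx measurableT mf.
have f_nd x a b : (a <= b)%N -> ((f_ a x)%:E <= (f_ b x)%:E).
  by move=> ab; rewrite lee_fin; exact/lefP/nd_nnsfun_approx.
transitivity (limn (fun n => \int[mdensity]_x (f_ n x)%:E)).
  rewrite -monotone_convergence//.
  - apply: eq_integral => x _; apply/esym/cvg_lim => //.
    by apply: cvg_nnsfun_approx => // y _; exact: f0.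
  - by move=> n; exact/measurable_EFinP.
  - by move=> n x _; rewrite lee_fin.
  - by move=> x _ a b ab; exact: f_nd.
under eq_fun do rewrite integral_mdensity_nnsfun.
rewrite -monotone_convergence//.
- apply: eq_integral => x _; apply/cvg_lim => //.
  by apply: cvgeZr => //; apply: cvg_nnsfun_approx => // y _; exact: f0.
- by move=> n; apply: emeasurable_funM => //; apply/measurable_EFinP.
- by move=> n x _; rewrite mule_ge0 ?lee_fin.
- by move=> x _ a b ab; apply: lee_wpmul2r; [rewrite lee_fin|exact: f_nd].
Qed.

End density.

Lemma ge0_integral_prod_mul {d1 d2} {T1 : measurableType d1}
    {T2 : measurableType d2} {R : realType}
    (m1 : {sigma_finite_measure set T1 -> \bar R})
    (m2 : {sigma_finite_measure set T2 -> \bar R})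
    (f : T1 -> \bar R) (g : T2 -> \bar R) :
  measurable_fun setT f -> measurable_fun setT g ->
  (forall x, 0 <= f x) -> (forall y, 0 <= g y) ->
  \int[m1 \x m2]_u (f u.1 * g u.2) = (\int[m1]_x f x) * (\int[m2]_y g y).
Proof.
move=> mf mg f0 g0; rewrite fubini_tonelli1.
- transitivity (\int[m1]_x (f x * \int[m2]_y g y)).
    by apply: eq_integral => x _; rewrite /fubini_F/= ge0_integralZl.
  by rewrite ge0_integralZr// integral_ge0.
- by apply: emeasurable_funM; apply: measurableT_comp.
- by move=> u; rewrite mule_ge0.
Qed.

(** * Coupling a common part as before and the remainders independently *)

Section gluing.
Context {disp} {T : measurableType disp} {R : realType}.
Variables (pi : probability (T * T)%type R) (w0 w1 w2 : T * T -> R) (r : R).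
Hypotheses (mw0 : measurable_fun setT w0) (mw1 : measurable_fun setT w1)
  (mw2 : measurable_fun setT w2).
Hypotheses (w0_ge0 : forall z, (0 <= w0 z)%R)
  (w1_ge0 : forall z, (0 <= w1 z)%R) (w2_ge0 : forall z, (0 <= w2 z)%R).
Hypotheses (w1r : \int[pi]_z (w1 z)%:E = r%:E)
  (w2r : \int[pi]_z (w2 z)%:E = r%:E)
  (w01 : \int[pi]_z (w0 z + w1 z)%:E = 1).

Let r_ge0 : (0 <= r)%R.
Proof. by rewrite -lee_fin -w1r integral_ge0// => z _; rewrite lee_fin. Qed.

(* When [r = 0] the weight is 0, since [0^-1 = 0]. *)
Let w12 (u : (T * T) * (T * T)) : R := (r^-1 * (w1 u.1 * w2 u.2))%R.

Let mw12 : measurable_fun setT w12.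
Proof.
by apply: measurable_funM => //; apply: measurable_funM;
  apply: measurableT_comp.
Qed.

Let w12_ge0 u : (0 <= w12 u)%R.
Proof. by rewrite !mulr_ge0// invr_ge0. Qed.

(** Of two independent pairs, keep the first point of one and the second point of the other. *)
Let ends (u : (T * T) * (T * T)) : T * T := (u.1.1, u.2.2).

Let mends : measurable_fun setT ends.
Proof.
apply/measurable_fun_pairP; split => /=.
  exact: (measurableT_comp measurable_fst measurable_fst).
exact: (measurableT_comp measurable_snd measurable_snd).
Qed.

(** The independent coupling of the two remainders, which have equal mass [r]: its marginals are
    those of [pi] weighted by [w1] on the first side and by [w2] on the second. *)
Let cross : {measure set (T * T) -> \bar R}.
Proof.
refine (pushforward (mdensity (pi \x pi) w12 mw12 w12_ge0) ends
  : {measure set _ -> \bar R}); exact: mends.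
Defined.

Let glued : {measure set (T * T) -> \bar R} :=
  measure_add (mdensity pi w0 mw0 w0_ge0) cross.

Let integral_glued (c : T * T -> R) : measurable_fun setT c ->
    (forall z, (0 <= c z)%R) ->
  \int[glued]_z (c z)%:E = \int[pi]_z (c z * w0 z)%:E
    + \int[pi \x pi]_u (c (ends u) * w12 u)%:E.
Proof.
move=> mc c0; have mc' : measurable_fun setT (EFin \o c).
  exact/measurable_EFinP.
rewrite ge0_integral_measure_add//; last by move=> z _; rewrite lee_fin.
congr (_ + _).
  by rewrite integral_mdensity// => z; rewrite lee_fin.
rewrite ge0_integral_pushforward//; last by move=> z _; rewrite lee_fin.
rewrite preimage_setT integral_mdensity//.
  exact: measurableT_comp.
by move=> u; rewrite lee_fin.
Qed.

(** Serves the case [r = 0], where [w1] and [w2] vanish almost everywhere. *)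
Let ae0 (f w : T * T -> R) : measurable_fun setT f -> measurable_fun setT w ->
  (forall z, (0 <= f z)%R) -> (forall z, (0 <= w z)%R) ->
  \int[pi]_z (w z)%:E = 0 -> \int[pi]_z (f z * w z)%:E = 0.
Proof.
move=> mf mw f0 wge0 iw0.
have mw' : measurable_fun setT (EFin \o w) by exact/measurable_EFinP.
have : \int[pi]_z `|(w z)%:E| = 0.
  by rewrite -iw0; apply: eq_integral => z _; rewrite gee0_abs// lee_fin.
move/(ae_eq_integral_abs pi measurableT mw') => w_ae.
rewrite (ae_eq_integral (cst 0))//.
- exact: integral0.
- by apply/measurable_EFinP/measurable_funM.
- by apply: filterS w_ae => z /= /(_ I)[wz] _; rewrite wz mulr0.
Qed.

(** Integrating out the second pair gives a factor [r], which cancels [r^-1]. If [r = 0], both sides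
    are 0. *)
Let integral_w12l (f : T * T -> R) : measurable_fun setT f ->
    (forall z, (0 <= f z)%R) ->
  \int[pi \x pi]_u (f u.1 * w12 u)%:E = \int[pi]_z (f z * w1 z)%:E.
Proof.
move=> mf f0.
transitivity (\int[pi \x pi]_u
    (r^-1%:E * ((f u.1 * w1 u.1)%:E * (w2 u.2)%:E))).
  by apply: eq_integral => u _; rewrite /w12 -!EFinM; congr EFin; ring.
rewrite ge0_integralZl//.
- rewrite (ge0_integral_prod_mul _ _ (fun z => (f z * w1 z)%:E)
    (fun z => (w2 z)%:E))//.
  + rewrite w2r; have [r0|r0] := eqVneq r 0%R.
      by rewrite r0 mule0 mule0 ae0// w1r r0.
    by rewrite muleCA -EFinM mulVf// mule1.
  + by apply/measurable_EFinP/measurable_funM.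
  + exact/measurable_EFinP.
  + by move=> z; rewrite lee_fin mulr_ge0.
- apply: emeasurable_funM; apply/measurable_EFinP.
    by apply: measurable_funM; apply: measurableT_comp.
  exact: measurableT_comp.
- by move=> u _; rewrite -EFinM lee_fin !mulr_ge0.
- by rewrite lee_fin invr_ge0.
Qed.

Let integral_w12r (f : T * T -> R) : measurable_fun setT f ->
    (forall z, (0 <= f z)%R) ->
  \int[pi \x pi]_u (f u.2 * w12 u)%:E = \int[pi]_z (f z * w2 z)%:E.
Proof.
move=> mf f0.
transitivity (\int[pi \x pi]_u
    (r^-1%:E * ((w1 u.1)%:E * (f u.2 * w2 u.2)%:E))).
  by apply: eq_integral => u _; rewrite /w12 -!EFinM; congr EFin; ring.
rewrite ge0_integralZl//.
- rewrite (ge0_integral_prod_mul _ _ (fun z => (w1 z)%:E)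
    (fun z => (f z * w2 z)%:E))//.
  + rewrite w1r; have [r0|r0] := eqVneq r 0%R.
      by rewrite r0 mul0e mule0 ae0// w2r r0.
    by rewrite muleA -EFinM mulVf// mul1e.
  + exact/measurable_EFinP.
  + by apply/measurable_EFinP/measurable_funM.
  + by move=> z; rewrite lee_fin mulr_ge0.
- apply: emeasurable_funM; apply/measurable_EFinP.
    exact: measurableT_comp.
  by apply: measurable_funM; apply: measurableT_comp.
- by move=> u _; rewrite -EFinM lee_fin !mulr_ge0.
- by rewrite lee_fin invr_ge0.
Qed.

Let integral_gluedl (f : T -> R) : measurable_fun setT f ->
    (forall x, (0 <= f x)%R) ->
  \int[glued]_z (f z.1)%:E = \int[pi]_z (f z.1 * (w0 z + w1 z))%:E.
Proof.
move=> mf f0; have mf1 : measurable_fun setT (fun z : T * T => f z.1).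
  exact: measurableT_comp.
rewrite (integral_glued (f \o fst))//= (integral_w12l (f \o fst))//=.
rewrite -ge0_integralD//.
- by apply: eq_integral => z _; rewrite -EFinD mulrDr.
- by move=> z _; rewrite lee_fin mulr_ge0.
- by apply/measurable_EFinP/measurable_funM.
- by move=> z _; rewrite lee_fin mulr_ge0.
- by apply/measurable_EFinP/measurable_funM.
Qed.

Let integral_gluedr (f : T -> R) : measurable_fun setT f ->
    (forall x, (0 <= f x)%R) ->
  \int[glued]_z (f z.2)%:E = \int[pi]_z (f z.2 * (w0 z + w2 z))%:E.
Proof.
move=> mf f0; have mf1 : measurable_fun setT (fun z : T * T => f z.2).
  exact: measurableT_comp.
rewrite (integral_glued (f \o snd))//= (integral_w12r (f \o snd))//=.
rewrite -ge0_integralD//.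
- by apply: eq_integral => z _; rewrite -EFinD mulrDr.
- by move=> z _; rewrite lee_fin mulr_ge0.
- by apply/measurable_EFinP/measurable_funM.
- by move=> z _; rewrite lee_fin mulr_ge0.
- by apply/measurable_EFinP/measurable_funM.
Qed.

Let glued_setT : glued setT = 1.
Proof.
have -> : glued setT = \int[glued]_z ((cst 1%R : T -> R) z.1)%:E.
  by rewrite -[LHS]mul1e -integral_cst.
rewrite integral_gluedl// -w01.
by apply: eq_integral => z _; rewrite mul1r.
Qed.

(* The mass w0 stays coupled as in pi, and the remaining masses w1 (first
   marginal) and w2 (second marginal) are coupled independently. *)
Lemma exists_glued_coupling : exists Q : probability (T * T)%type R,
  [/\ forall A, measurable A ->
        Q (A `*` setT) = \int[pi]_z (\1_A z.1 * (w0 z + w1 z))%:E,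
      forall A, measurable A ->
        Q (setT `*` A) = \int[pi]_z (\1_A z.2 * (w0 z + w2 z))%:E &
      forall (c : T * T -> R) (c1 c2 : T -> R),
        measurable_fun setT c -> measurable_fun setT c1 ->
        measurable_fun setT c2 -> (forall z, (0 <= c z)%R) ->
        (forall x, (0 <= c1 x)%R) -> (forall x, (0 <= c2 x)%R) ->
        (forall x y, (c (x, y) <= c1 x + c2 y)%R) ->
        \int[Q]_z (c z)%:E <=
        \int[pi]_z (c z * w0 z + c1 z.1 * w1 z + c2 z.2 * w2 z)%:E].
Proof.
(* [glued] has mass 1, so normalising leaves it unchanged and only supplies the probability
   structure; [pi] is the default for a degenerate mass and is never reached. *)
pose Q : probability (T * T)%type R := mnormalize glued pi.
have QE A : Q A = glued A.
  by rewrite /Q/= /mnormalize glued_setT onee_eq0/= invr1 mule1.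
exists Q; split=> [A mA|A mA|c c1 c2 mc mc1 mc2 c0 c10 c20 cc].
- rewrite QE -integral_gluedl//.
  rewrite -[LHS]mul1e -integral_cst//; last exact: measurableX.
  rewrite integral_mkcond; apply: eq_integral => z _.
  rewrite /patch indicE in_setX in_setT andbT.
  by case: (_ \in A).
- rewrite QE -integral_gluedr//.
  rewrite -[LHS]mul1e -integral_cst//; last exact: measurableX.
  rewrite integral_mkcond; apply: eq_integral => z _.
  rewrite /patch indicE in_setX in_setT.
  by case: (_ \in A).
- rewrite (eq_measure_integral glued); last by move=> A _ _; exact: QE.
  have mc11 : measurable_fun setT (fun z : T * T => c1 z.1).
    exact: measurableT_comp.
  have mc22 : measurable_fun setT (fun z : T * T => c2 z.2).
    exact: measurableT_comp.
  have mp (f w : T * T -> R) : measurable_fun setT f -> measurable_fun setT w ->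
      measurable_fun setT (fun z : T * T => (f z * w z)%:E).
    by move=> mf mw; apply/measurable_EFinP/measurable_funM.
  rewrite integral_glued//.
  under [leRHS]eq_integral do rewrite -addrA !EFinD.
  rewrite ge0_integralD//; last 4 first.
  - by move=> z _; rewrite lee_fin mulr_ge0.
  - exact: mp.
  - by move=> z _; rewrite adde_ge0// lee_fin mulr_ge0.
  - by apply: emeasurable_funD; exact: mp.
  rewrite ge0_integralD//; last 4 first.
  - by move=> z _; rewrite lee_fin mulr_ge0.
  - exact: mp.
  - by move=> z _; rewrite lee_fin mulr_ge0.
  - exact: mp.
  rewrite leeD2l//.
  (* The two one-point costs are written back as integrals over [pi \x pi] against [w12], so that
     the hypothesis on [c] applies pointwise at [ends u]. *)
  have <- := integral_w12l (fun z => c1 z.1) mc11 (fun z => c10 z.1).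
  have <- := integral_w12r (fun z => c2 z.2) mc22 (fun z => c20 z.2).
  rewrite -ge0_integralD//; last 4 first.
  - by move=> u _; rewrite lee_fin mulr_ge0.
  - apply/measurable_EFinP/measurable_funM => //.
    exact: (measurableT_comp mc11 measurable_fst).
  - by move=> u _; rewrite lee_fin mulr_ge0.
  - apply/measurable_EFinP/measurable_funM => //.
    exact: (measurableT_comp mc22 measurable_snd).
  apply: ge0_le_integral => //.
  - by move=> u _; rewrite lee_fin mulr_ge0.
  - apply/measurable_EFinP/measurable_funM => //.
    exact: measurableT_comp.
  - apply: emeasurable_funD; apply/measurable_EFinP/measurable_funM => //.
      exact: (measurableT_comp mc11 measurable_fst).
    exact: (measurableT_comp mc22 measurable_snd).
  - move=> u _; rewrite -EFinD lee_fin -mulrDl ler_wpM2r//.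
    exact: cc.
Qed.

End gluing.

(** * The Wasserstein distance and the action of Markov kernels *)

Section wasserstein_theory.
Context {R : realType} {d : nat}.
Local Notation E := 'rV[R]_d.
Implicit Types (mu nu : probability E R) (M : R.-pker E ~> E).

Lemma measurable_enorm_id : measurable_fun setT (@enorm R d).
Proof. by apply: measurable_enorm => i; exact: measurable_coord. Qed.

Lemma measurable_enorm_dist :
  measurable_fun setT (fun z : E * E => enorm (z.1 - z.2)).
Proof.
apply: measurable_enorm => i.
rewrite (_ : (fun _ => _) =
  (fun z : E * E => z.1 ord0 i - z.2 ord0 i)%R); last first.
  by apply/funext => z; rewrite !mxE.
by apply: measurable_funB;
  [exact: (measurableT_comp (measurable_coord i) measurable_fst)
  |exact: (measurableT_comp (measurable_coord i) measurable_snd)].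
Qed.

Lemma W1_ge0 mu nu : 0 <= W1 mu nu.
Proof.
apply: le_ereal_inf_tmp => _ [pi _ <-].
by apply: integral_ge0 => z _; rewrite lee_fin enorm_ge0.
Qed.

Lemma W1_le_cost mu nu pi : couplings mu nu pi ->
  W1 mu nu <= \int[pi]_z (enorm (z.1 - z.2))%:E.
Proof. by move=> cpi; apply: ereal_inf_lbound; exists pi. Qed.

(** The image of [mu] under the diagonal map is a coupling of zero cost. *)
Lemma W1_eq0 mu nu : measure_eq mu nu -> W1 mu nu = 0.
Proof.
move=> munu; apply/eqP; rewrite eq_le W1_ge0 andbT.
have mdiag : measurable_fun setT (fun x : E => (x, x)).
  exact: measurable_fun_pair.
pose diag : {mfun E >-> (E * E)%type} :=
  HB.pack (fun x : E => (x, x)) (isMeasurableFun.Build _ _ _ _ _ mdiag).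
apply: le_trans (W1_le_cost mu nu (distribution mu diag) _) _.
  split=> A mA.
    rewrite /distribution /pushforward; congr (mu _).
    by apply/seteqP; split => x //= [].
  rewrite -munu// /distribution /pushforward; congr (mu _).
  by apply/seteqP; split => x //= [].
rewrite ge0_integral_distribution//.
- by rewrite integral0_eq// => x _ /=; rewrite subrr enorm0.
- by apply/measurable_EFinP; exact: measurable_enorm_dist.
- by move=> z; rewrite lee_fin enorm_ge0.
Qed.

(** The product coupling costs at most [M1 mu + M1 nu], by the triangle inequality through the
    origin. *)
Lemma W1_lty mu nu : P1 mu -> P1 nu -> W1 mu nu < +oo.
Proof.
move=> mu1 nu1; have menorm : measurable_fun setT (fun x : E => (enorm x)%:E).
  by apply/measurable_EFinP; exact: measurable_enorm_id.
have menorm1 : measurable_fun setT (fun z : E * E => (enorm z.1)%:E).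
  exact: (measurableT_comp menorm measurable_fst).
have menorm2 : measurable_fun setT (fun z : E * E => (enorm z.2)%:E).
  exact: (measurableT_comp menorm measurable_snd).
apply: le_lt_trans (W1_le_cost mu nu (mu \x nu) _) _.
  split=> A mA.
    by rewrite /= product_measure1E// [X in _ * X]probability_setT mule1.
  by rewrite /= product_measure1E// [X in X * _]probability_setT mul1e.
apply: (@le_lt_trans _ _
    (\int[mu \x nu]_z ((enorm z.1)%:E + (enorm z.2)%:E))).
  apply: ge0_le_integral => //.
  - by move=> z _; rewrite lee_fin enorm_ge0.
  - by apply/measurable_EFinP; exact: measurable_enorm_dist.
  - exact: emeasurable_funD.
  - by move=> z _; rewrite -EFinD lee_fin ler_enormB.
rewrite ge0_integralD//; last 2 first.
- by move=> z _; rewrite lee_fin enorm_ge0.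
- by move=> z _; rewrite lee_fin enorm_ge0.
have -> : \int[mu \x nu]_z (enorm z.1)%:E = M1 mu.
  under eq_integral do rewrite -[(enorm _)%:E]mule1.
  rewrite (ge0_integral_prod_mul _ _ (fun x => (enorm x)%:E) (cst 1))//.
    by rewrite integral_cst// mul1e [X in _ * X]probability_setT mule1.
  by move=> x; rewrite lee_fin enorm_ge0.
have -> : \int[mu \x nu]_z (enorm z.2)%:E = M1 nu.
  under eq_integral do rewrite -[(enorm _)%:E]mul1e.
  rewrite (ge0_integral_prod_mul _ _ (cst 1) (fun x => (enorm x)%:E))//.
    by rewrite integral_cst// mul1e [X in X * _]probability_setT mul1e.
  by move=> x; rewrite lee_fin enorm_ge0.
exact: lte_add_pinfty.
Qed.

Lemma kact_measure_eq mu nu M :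
  measure_eq mu nu -> measure_eq (kact mu M) (kact nu M).
Proof.
by move=> munu A mA; apply: eq_measure_integral => B mB _; exact: munu.
Qed.

(** A distinct pair is required: over an empty set of pairs, as in dimension 0, the supremum is
    -oo. *)
Lemma tau1_ge0 mu nu M : P1 mu -> P1 nu -> ~ measure_eq mu nu -> 0 <= tau1 M.
Proof.
move=> mu1 nu1 munu.
apply: (@le_trans _ _ (W1 (kact mu M) (kact nu M) / W1 mu nu)).
  by rewrite mule_ge0 ?inve_ge0 ?W1_ge0.
by apply: ereal_sup_ubound; exists mu, nu.
Qed.

(* If W1 mu nu = 0 although mu and nu differ, the ratio in the definition of
   tau1 is [x / 0], that is +oo unless x = 0. *)
Lemma W1_kact_le mu nu M : P1 mu -> P1 nu -> tau1 M < +oo ->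
  W1 (kact mu M) (kact nu M) <= tau1 M * W1 mu nu.
Proof.
move=> mu1 nu1 tauM; have [munu|munu] := pselect (measure_eq mu nu).
  by rewrite !W1_eq0 ?mule0//; exact: kact_measure_eq.
have ratio : W1 (kact mu M) (kact nu M) / W1 mu nu <= tau1 M.
  by apply: ereal_sup_ubound; exists mu, nu.
have := W1_lty mu nu mu1 nu1; have := W1_ge0 mu nu; move: ratio.
case: (W1 mu nu) => [r| |]// ratio; rewrite lee_fin => r_ge0 _.
move: r_ge0; rewrite le_eqVlt => /predU1P[r0|r0]; last first.
  by move: ratio; rewrite inver gt_eqF// lee_pdivrMr.
(* With a zero denominator, a positive numerator would force [tau1 M = +oo], against [tauM]. *)
move: ratio; rewrite -r0 inve0 mule0.
have := W1_ge0 (kact mu M) (kact nu M); rewrite le_eqVlt => /predU1P[<-//|W0].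
by rewrite gt0_muley// leye_eq => /eqP e; rewrite e ltxx in tauM.
Qed.

End wasserstein_theory.

(** * Lipschitz estimate for the Boltzmann-Gibbs map *)

Section gibbs_wasserstein.
Context {R : realType} {d : nat}.
Local Notation E := 'rV[R]_d.
Implicit Types (mu nu eta : probability E R).

Lemma integral_between {disp} {T : measurableType disp} (P : probability T R)
    (f : T -> R) (a b : R) : measurable_fun setT f -> (0 <= a)%R ->
  (forall x, (a <= f x <= b)%R) ->
  exists2 r, \int[P]_x (f x)%:E = r%:E & (a <= r <= b)%R.
Proof.
move=> mf a0 fab.
have f0 x : (0 <= f x)%R by have /andP[+ _] := fab x; exact: le_trans.
have cE (k : R) : k%:E = \int[P]_x (cst k%:E) x.
  by rewrite integral_cst// [X in _ * X]probability_setT mule1.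
have mf' : measurable_fun setT (EFin \o f) by exact/measurable_EFinP.
have le1 : a%:E <= \int[P]_x (f x)%:E.
  rewrite (cE a); apply: ge0_le_integral => //.
  by move=> x _; rewrite lee_fin; have /andP[] := fab x.
have le2 : \int[P]_x (f x)%:E <= b%:E.
  rewrite (cE b); apply: ge0_le_integral => //.
    by move=> x _; rewrite lee_fin.
  by move=> x _; rewrite lee_fin; have /andP[] := fab x.
move: le1 le2; case: (\int[P]_x (f x)%:E) => // r; rewrite !lee_fin => ar rb.
by exists r; rewrite ?ar.
Qed.

Lemma integral_marginals mu nu pi (f : E -> \bar R) : couplings mu nu pi ->
  measurable_fun setT f -> (forall x, 0 <= f x) ->
  \int[pi]_z f z.1 = \int[mu]_x f x /\ \int[pi]_z f z.2 = \int[nu]_x f x.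
Proof.
move=> [pi1 pi2] mf f0; split.
- transitivity (\int[pushforward pi fst]_x f x).
    by rewrite ge0_integral_pushforward.
  apply: eq_measure_integral => A mA _.
  rewrite -[RHS](pi1 _ mA) /pushforward; congr (pi _).
  by apply/seteqP; split => z // [].
- transitivity (\int[pushforward pi snd]_x f x).
    by rewrite ge0_integral_pushforward.
  apply: eq_measure_integral => A mA _.
  rewrite -[RHS](pi2 _ mA) /pushforward; congr (pi _).
  by apply/seteqP; split => z // [].
Qed.

Context (G : E -> R) (eps A B L : R).
Hypotheses (cG : C1 G) (eps0 : (0 < eps)%R)
  (G_ge : forall x, (eps <= G x)%R) (G_le : forall x, (G x <= A)%R)
  (GB : forall z, (enorm z * enorm (grad G z) <= B)%R)
  (L_ge0 : (0 <= L)%R)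
  (GL : forall x y, (`|G x - G y| <= L * enorm (x - y))%R).

Let mG : measurable_fun setT G. Proof. exact: C1_measurable. Qed.

Let G0 x : (0 <= G x)%R. Proof. exact: le_trans (ltW eps0) (G_ge x). Qed.

Let GA x : (0 <= G x <= A)%R. Proof. by rewrite G0 G_le. Qed.

Let A0 : (0 < A)%R.
Proof. exact: lt_le_trans eps0 (le_trans (G_ge 0%R) (G_le _)). Qed.

Let B0 : (0 <= B)%R.
Proof. by apply: le_trans (GB 0%R); rewrite enorm0 mul0r. Qed.

Let menorm : measurable_fun setT (fun x : E => (enorm x)%:E).
Proof. by apply/measurable_EFinP; exact: measurable_enorm_id. Qed.

(** Presents the Boltzmann-Gibbs measure through the density [r^-1 * G], with a real normalising
    constant bounded below, as the gluing requires. *)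
Lemma gibbsE eta : exists r : R,
  [/\ (eps <= r)%R, \int[eta]_x (G x)%:E = r%:E,
      \int[eta]_x (r^-1 * G x)%:E = 1 &
      forall S, measurable S ->
        boltzmann_gibbs G eta S = \int[eta]_(x in S) (r^-1 * G x)%:E].
Proof.
have [r Gr /andP[er rA]] : exists2 r, \int[eta]_x (G x)%:E = r%:E
    & (eps <= r <= A)%R.
  by apply: (integral_between _ _ _ _ mG (ltW eps0)) => x; rewrite G_ge G_le.
have r0 : (0 < r)%R by exact: lt_le_trans er.
have uE S : measurable S ->
    \int[eta]_(x in S) (r^-1 * G x)%:E = (\int[eta]_(x in S) (G x)%:E) / r%:E.
  move=> mS; under eq_integral do rewrite EFinM.
  rewrite ge0_integralZl//.
  - by rewrite inver gt_eqF// muleC.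
  - exact/measurable_funTS/measurable_EFinP.
  - by move=> x _; rewrite lee_fin.
  - by rewrite lee_fin invr_ge0 ltW.
exists r; split=> // [|S mS]; first by rewrite uE// Gr divee ?gt_eqF// lte_fin.
by rewrite uE// (boltzmann_gibbsE _ mG eps0 G_ge G_le mS) Gr.
Qed.

Lemma gibbs_measure_eq mu nu : measure_eq mu nu ->
  measure_eq (boltzmann_gibbs G mu) (boltzmann_gibbs G nu).
Proof.
move=> munu S mS; have gE eta := boltzmann_gibbsE eta mG eps0 G_ge G_le mS.
apply: (etrans (gE mu)); apply: (etrans _ (esym (gE nu))).
by congr (_ / _); apply: eq_measure_integral => S' mS' _; exact: munu.
Qed.

(** The density is at most [eps^-1 * A], so the first moment grows by at most that factor. *)
Lemma P1_gibbs eta : P1 eta -> P1 (boltzmann_gibbs G eta).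
Proof.
move=> eta1; have [r [er _ _ gE]] := gibbsE eta.
have r0 : (0 < r)%R by exact: lt_le_trans er.
have u0 : (0 <= r^-1)%R by rewrite invr_ge0 ltW.
have ue : (r^-1 <= eps^-1)%R by rewrite lef_pV2 ?posrE.
have muG : measurable_fun setT (fun x => r^-1 * G x)%R.
  exact: measurable_funM.
have uG0 x : (0 <= r^-1 * G x)%R by rewrite mulr_ge0.
rewrite /P1/= /M1 (eq_measure_integral (mdensity eta _ muG uG0)); last first.
  by move=> S mS _; exact: gE.
rewrite integral_mdensity//; last by move=> x; rewrite lee_fin enorm_ge0.
apply: (@le_lt_trans _ _ (\int[eta]_x ((eps^-1 * A)%:E * (enorm x)%:E))).
  apply: ge0_le_integral => //.
  - by move=> x _; rewrite mule_ge0 ?lee_fin ?enorm_ge0.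
  - by apply: emeasurable_funM => //; exact/measurable_EFinP.
  - exact: emeasurable_funM.
  - move=> x _; rewrite muleC lee_wpmul2r ?lee_fin ?enorm_ge0//.
    exact: ler_pM.
rewrite ge0_integralZl//.
- by rewrite lte_mul_pinfty// lee_fin mulr_ge0// ?invr_ge0 ltW.
- by move=> x _; rewrite lee_fin enorm_ge0.
- by rewrite lee_fin mulr_ge0// ?invr_ge0 ltW.
Qed.

Let mean_le mu nu pi (a b : R) : couplings mu nu pi ->
  \int[mu]_x (G x)%:E = a%:E -> \int[nu]_x (G x)%:E = b%:E ->
  `|b - a|%:E <= L%:E * \int[pi]_z (enorm (z.1 - z.2))%:E.
Proof.
move=> cpi Ga Gb.
have mG' : measurable_fun setT (EFin \o G) by exact/measurable_EFinP.
have [] := integral_marginals mu nu pi (EFin \o G) cpi mG'.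
  by move=> x; rewrite lee_fin.
rewrite /= Ga Gb => pia pib.
have mc : measurable_fun setT (fun z : E * E => (enorm (z.1 - z.2))%:E).
  by apply/measurable_EFinP; exact: measurable_enorm_dist.
have mG1 : measurable_fun setT (fun z : E * E => (G z.1)%:E).
  exact: (measurableT_comp mG' measurable_fst).
have mG2 : measurable_fun setT (fun z : E * E => (G z.2)%:E).
  exact: (measurableT_comp mG' measurable_snd).
have c0 z : 0 <= (enorm (z.1 - z.2))%:E :> \bar R.
  by rewrite lee_fin enorm_ge0.
have mLc : measurable_fun setT
    (fun z : E * E => L%:E * (enorm (z.1 - z.2))%:E).
  exact: measurable_funeM.
(* The inequality is kept additive because the cost may be infinite. It is used once for each sign
   of [b - a]. *)
have key (f g : E * E -> R) (r s : R) : measurable_fun setT (EFin \o f) ->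
    measurable_fun setT (EFin \o g) ->
    (forall z, 0 <= f z)%R -> (forall z, 0 <= g z)%R ->
    (forall z, f z <= g z + L * enorm (z.1 - z.2))%R ->
    \int[pi]_z (f z)%:E = r%:E -> \int[pi]_z (g z)%:E = s%:E ->
    (r - s)%:E <= L%:E * \int[pi]_z (enorm (z.1 - z.2))%:E.
  move=> mf mg f0 g0 fg fr gs; rewrite EFinB leeBlDl// -fr -gs.
  rewrite -ge0_integralZl// -ge0_integralD//; last 2 first.
  - by move=> z _; rewrite lee_fin.
  - by move=> z _; rewrite mule_ge0.
  apply: ge0_le_integral => //.
  - by move=> z _; rewrite lee_fin.
  - exact: emeasurable_funD.
  - by move=> z _; rewrite -EFinM -EFinD lee_fin.
have GLe x y : (G x <= G y + L * enorm (x - y))%R.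
  by have := ler_norm (G x - G y); have := GL x y; lra.
have [ab|ab] := leP 0%R (b - a)%R.
  rewrite ger0_norm//; apply: key pib pia => // z.
  by rewrite enorm_distC.
rewrite ltr0_norm// opprB; exact: key pia pib.
Qed.

Lemma W1_gibbs_le mu nu : P1 nu ->
  W1 (boltzmann_gibbs G mu) (boltzmann_gibbs G nu) <=
  (((B + A) / eps)%:E + (L * A / eps ^+ 2)%:E * M1 nu) * W1 mu nu.
Proof.
move=> nu1; have [m M1E m0] : exists2 m : R, M1 nu = m%:E & (0 <= m)%R.
  have : 0 <= M1 nu by apply: integral_ge0 => x _; rewrite lee_fin enorm_ge0.
  by move: nu1; rewrite /P1/=; case: (M1 nu) => // m _; exists m.
have eps2 : (0 <= (eps ^+ 2)^-1)%R by rewrite invr_ge0 exprn_ge0// ltW.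
pose K : R := ((B + A) / eps + L * A / eps ^+ 2 * m)%R.
have K0 : (0 < K)%R.
  rewrite ltr_wpDr//; first by rewrite !mulr_ge0// (ltW A0).
  by rewrite divr_gt0// ltr_wpDl.
(* As [K] is positive and finite, dividing by it turns the goal into a lower bound for the infimum
   over couplings, so each coupling can be treated separately. *)
suff cost_le pi : couplings mu nu pi ->
    W1 (boltzmann_gibbs G mu) (boltzmann_gibbs G nu) <=
    K%:E * \int[pi]_z (enorm (z.1 - z.2))%:E.
  rewrite M1E -EFinM -EFinD -/K -lee_pdivrMl//.
  apply: le_ereal_inf_tmp => _ [pi cpi <-].
  by rewrite lee_pdivrMl//; exact: cost_le.
move=> cpi.
have [a [ea Ga ua gaE]] := gibbsE mu.
have [b [eb Gb vb gbE]] := gibbsE nu.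
have a0 : (0 < a)%R by exact: lt_le_trans ea.
have b0 : (0 < b)%R by exact: lt_le_trans eb.
have u0 : (0 <= a^-1)%R by rewrite invr_ge0 ltW.
have v0 : (0 <= b^-1)%R by rewrite invr_ge0 ltW.
have muG : measurable_fun setT (fun x => a^-1 * G x)%R.
  exact: measurable_funM.
have mvG : measurable_fun setT (fun x => b^-1 * G x)%R.
  exact: measurable_funM.
have uG0 x : (0 <= a^-1 * G x)%R by rewrite mulr_ge0.
have vG0 x : (0 <= b^-1 * G x)%R by rewrite mulr_ge0.
have muG1 : measurable_fun setT (fun z : E * E => a^-1 * G z.1)%R.
  exact: (measurableT_comp muG measurable_fst).
have mvG2 : measurable_fun setT (fun z : E * E => b^-1 * G z.2)%R.
  exact: (measurableT_comp mvG measurable_snd).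
pose w0 (z : E * E) : R := (Num.min (a^-1 * G z.1) (b^-1 * G z.2))%R.
pose w1 (z : E * E) : R := (Num.max 0 (a^-1 * G z.1 - b^-1 * G z.2))%R.
pose w2 (z : E * E) : R := (Num.max 0 (b^-1 * G z.2 - a^-1 * G z.1))%R.
have mw0 : measurable_fun setT w0 by exact: measurable_minr.
have mw1 : measurable_fun setT w1.
  by apply: measurable_maxr => //; exact: measurable_funB.
have mw2 : measurable_fun setT w2.
  by apply: measurable_maxr => //; exact: measurable_funB.
have w0_ge0 z : (0 <= w0 z)%R by rewrite /w0 le_min uG0 vG0.
have w1_ge0 z : (0 <= w1 z)%R by rewrite /w1 le_max lexx.
have w2_ge0 z : (0 <= w2 z)%R by rewrite /w2 le_max lexx.
(* [w0 + w1] is the density of the first Gibbs measure at [z.1], and [w0 + w2] that of the second at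
   [z.2]. *)
have w01E z : (w0 z + w1 z = a^-1 * G z.1)%R.
  rewrite /w0 /w1; case: leP; rewrite ?subr_ge0 ?subr_lt0 => h.
    by rewrite (min_idPr h) addrC subrK.
  by rewrite (min_idPl (ltW h)) addr0.
have w02E z : (w0 z + w2 z = b^-1 * G z.2)%R.
  rewrite /w0 /w2; case: leP; rewrite ?subr_ge0 ?subr_lt0 => h.
    by rewrite (min_idPl h) addrC subrK.
  by rewrite (min_idPr (ltW h)) addr0.
have marg1 (f : E -> R) : measurable_fun setT f -> (forall x, (0 <= f x)%R) ->
    \int[pi]_z (f z.1)%:E = \int[mu]_x (f x)%:E.
  move=> mf f0; have mf' : measurable_fun setT (EFin \o f).
    exact/measurable_EFinP.
  by have [//|+ _] := integral_marginals mu nu pi (EFin \o f) cpi mf'.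
have marg2 (f : E -> R) : measurable_fun setT f -> (forall x, (0 <= f x)%R) ->
    \int[pi]_z (f z.2)%:E = \int[nu]_x (f x)%:E.
  move=> mf f0; have mf' : measurable_fun setT (EFin \o f).
    exact/measurable_EFinP.
  by have [//|_ +] := integral_marginals mu nu pi (EFin \o f) cpi mf'.
have w01 : \int[pi]_z (w0 z + w1 z)%:E = 1.
  by under eq_integral do rewrite w01E; rewrite (marg1 _ muG uG0).
have w02 : \int[pi]_z (w0 z + w2 z)%:E = 1.
  by under eq_integral do rewrite w02E; rewrite (marg2 _ mvG vG0).
have iD (w : E * E -> R) : measurable_fun setT w -> (forall z, 0 <= w z)%R ->
    \int[pi]_z (w0 z + w z)%:E =
    \int[pi]_z (w0 z)%:E + \int[pi]_z (w z)%:E.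
  move=> mw w_ge0; under eq_integral do rewrite EFinD.
  by rewrite ge0_integralD//; first [exact/measurable_EFinP
    | move=> z _; rewrite lee_fin].
have ge0i (w : E * E -> R) : (forall z, 0 <= w z)%R ->
    0 <= \int[pi]_z (w z)%:E.
  by move=> w_ge0; apply: integral_ge0 => z _; rewrite lee_fin.
(* Both sums integrate to 1 and share the [w0] part, so the remainders have equal mass; an infinite
   integral would contradict the total 1. *)
have [r w1r w2r] : exists2 r, \int[pi]_z (w1 z)%:E = r%:E
    & \int[pi]_z (w2 z)%:E = r%:E.
  move: w01 w02 (ge0i _ w0_ge0) (ge0i _ w1_ge0) (ge0i _ w2_ge0).
  rewrite !iD//; case: (\int[pi]_z (w0 z)%:E) => [s0| |]//;
    case: (\int[pi]_z (w1 z)%:E) => [s1| |]//;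
    case: (\int[pi]_z (w2 z)%:E) => [s2| |]//.
  rewrite -!EFinD => -[s01] [s02] _ _ _; exists s1 => //; congr EFin.
  by lra.
have [Q [Q1 Q2 Qcost]] := exists_glued_coupling pi w0 w1 w2 r mw0 mw1 mw2
  w0_ge0 w1_ge0 w2_ge0 w1r w2r w01.
have indE (w S : _) (eta : probability E R) : measurable S ->
    \int[eta]_x (\1_S x * w x)%:E = \int[eta]_(x in S) (w x)%:E.
  move=> mS; rewrite [RHS]integral_mkcond; apply: eq_integral => x _.
  by rewrite /patch indicE; case: ifP => _; rewrite ?mul1r ?mul0r.
have cQ : couplings (boltzmann_gibbs G mu) (boltzmann_gibbs G nu) Q.
  split=> S mS.
    rewrite Q1// gaE// -indE//.
    under eq_integral do rewrite w01E.
    rewrite (marg1 (fun x => \1_S x * (a^-1 * G x))%R)//.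
      exact: measurable_funM.
    by move=> x; rewrite mulr_ge0.
  rewrite Q2// gbE// -indE//.
  under eq_integral do rewrite w02E.
  rewrite (marg2 (fun x => \1_S x * (b^-1 * G x))%R)//.
    exact: measurable_funM.
  by move=> x; rewrite mulr_ge0.
(* The independent part is charged |x| + |y|, that is, transported through the origin. *)
apply: le_trans (W1_le_cost _ _ _ cQ) _.
apply: le_trans (Qcost _ _ _ measurable_enorm_dist measurable_enorm_id
  measurable_enorm_id _ _ _ _) _.
- by move=> z; exact: enorm_ge0.
- exact: enorm_ge0.
- exact: enorm_ge0.
- exact: ler_enormB.
set C := \int[pi]_z (enorm (z.1 - z.2))%:E.
have mcost : measurable_fun setT (fun z : E * E => (enorm (z.1 - z.2))%:E).
  by apply/measurable_EFinP; exact: measurable_enorm_dist.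
have menorm2 : measurable_fun setT (fun z : E * E => (enorm z.2)%:E).
  exact: (measurableT_comp menorm measurable_snd).
(* Integrates [transport_weight], used with [a^-1] and [b^-1]; the second marginal turns the |y|
   term into [M1 nu]. *)
apply: (@le_trans _ _ (((B + A) * a^-1)%:E * C
    + (A * `|b^-1 - a^-1|)%:E * m%:E)).
  rewrite -M1E /M1 -(marg2 (@enorm R d))//; last 2 first.
  - exact: measurable_enorm_id.
  - exact: enorm_ge0.
  rewrite /C -!ge0_integralZl//; last 4 first.
  - by move=> z _; rewrite lee_fin enorm_ge0.
  - by rewrite lee_fin mulr_ge0// ltW.
  - by move=> z _; rewrite lee_fin enorm_ge0.
  - by rewrite lee_fin mulr_ge0// addr_ge0// ltW.
  rewrite -ge0_integralD//; last 4 first.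
  - move=> z _; rewrite -EFinM lee_fin !mulr_ge0 ?enorm_ge0//.
    by rewrite addr_ge0// ltW.
  - exact: measurable_funeM.
  - by move=> z _; rewrite -EFinM lee_fin !mulr_ge0 ?enorm_ge0// ltW.
  - exact: measurable_funeM.
  apply: ge0_le_integral => //.
  - move=> z _; rewrite lee_fin.
    by rewrite !addr_ge0// mulr_ge0// enorm_ge0.
  - apply/measurable_EFinP; apply: measurable_funD.
      apply: measurable_funD.
        by apply: measurable_funM => //; exact: measurable_enorm_dist.
      apply: measurable_funM => //.
      exact: (measurableT_comp measurable_enorm_id measurable_fst).
    apply: measurable_funM => //.
    exact: (measurableT_comp measurable_enorm_id measurable_snd).
  - by apply: emeasurable_funD; exact: measurable_funeM.
  - move=> [x y] _; rewrite -!EFinM -EFinD lee_fin.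
    exact: transport_weight.
(* 1/b - 1/a = (a - b) / (b a), and both [a] and [b] are at least [eps]. *)
have ba : (`|b^-1 - a^-1| <= (eps ^+ 2)^-1 * `|b - a|)%R.
  have -> : (b^-1 - a^-1 = (b * a)^-1 * (a - b))%R.
    by field; rewrite !gt_eqF.
  rewrite normrM distrC ler_wpM2r// ger0_norm; last first.
    by rewrite invr_ge0 mulr_ge0// ltW.
  rewrite lef_pV2 ?posrE ?mulr_gt0 ?exprn_gt0// expr2.
  by apply: ler_pM => //; exact: ltW.
have C0 : 0 <= C by apply: ge0i => z; exact: enorm_ge0.
apply: (@le_trans _ _ (((B + A) / eps)%:E * C
    + (A * (eps ^+ 2)^-1 * m)%:E * `|b - a|%:E)).
  apply: leeD.
    rewrite lee_wpmul2r// lee_fin ler_wpM2l ?addr_ge0 ?(ltW A0)//.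
    by rewrite lef_pV2 ?posrE.
  rewrite -!EFinM lee_fin; have Am0 : (0 <= A * m)%R.
    by rewrite mulr_ge0// ltW.
  have -> : (A * (eps ^+ 2)^-1 * m * `|b - a|
      = A * m * ((eps ^+ 2)^-1 * `|b - a|))%R by ring.
  by rewrite mulrAC ler_wpM2l.
apply: (@le_trans _ _ (((B + A) / eps)%:E * C
    + (A * (eps ^+ 2)^-1 * m)%:E * (L%:E * C))).
  rewrite leeD2l// lee_wpmul2l//.
    by rewrite lee_fin !mulr_ge0// (ltW A0).
  exact: (mean_le _ _ _ _ _ cpi Ga Gb).
rewrite muleA -ge0_muleDl//; last 2 first.
- by rewrite lee_fin divr_ge0// ?(ltW eps0)// addr_ge0// (ltW A0).
- by rewrite -EFinM lee_fin !mulr_ge0// (ltW A0).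
rewrite -EFinM -EFinD lee_wpmul2r// lee_fin /K lerD2l.
by rewrite le_eqVlt; apply/orP; left; apply/eqP; ring.
Qed.

End gibbs_wasserstein.

(** * Attainment of the best Lipschitz constant, and the final estimate *)

(** The infimum is attained: each quotient |G x - G y| / |x - y| is below every admissible constant,
    hence below their infimum. If |x - y| = 0, any admissible constant already forces
    [G x = G y]. *)
Lemma lip_normP {R : realType} {d : nat} (G : 'rV[R]_d -> R) :
  lip_norm G < +oo -> exists2 L : R, (0 <= L)%R & lip_norm G = L%:E /\
    forall x y, (`|G x - G y| <= L * enorm (x - y))%R.
Proof.
move=> Glip.
have G_ge0 : 0 <= lip_norm G.
  by apply: le_ereal_inf_tmp => _ [L [L0 _] <-]; rewrite lee_fin.
have [_ [L0 [L00 L0G] <-] _] := ereal_inf_lt Glip.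
move: Glip G_ge0; case E : (lip_norm G) => [L| |]// _; rewrite lee_fin => L_ge0.
exists L => //; split=> // x y.
have := enorm_ge0 (x - y); rewrite le_eqVlt => /predU1P[e0|e0].
  by have := L0G x y; rewrite -e0 !mulr0.
rewrite -ler_pdivrMr// -lee_fin -E; apply: le_ereal_inf_tmp => _ [K [_ KG] <-].
by rewrite lee_fin ler_pdivrMr.
Qed.

Theorem corollary5p2 (R : realType) (d : nat)
  (G : nat -> 'rV[R]_d -> R) (eps : R) (Gbar Gtil : nat -> R)
  (M : nat -> R.-pker 'rV[R]_d ~> 'rV[R]_d)
  (eps_gt0 : (0 < eps)%R)
  (G_C1 : forall n, C1 (G n))
  (G_gt : forall n x, (eps < G n x)%R)
  (G_le : forall n x, (G n x <= Gbar n)%R)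
  (G_lip : forall n, lip_norm (G n) < +oo)
  (G_til : forall n,
     ereal_sup [set (enorm z * enorm (grad (G n) z))%:E | z in setT]
       <= (Gtil n)%:E)
  (M_P1 : forall n x, (1 <= n)%N ->
     \int[M n x]_y (enorm y)%:E < +oo)
  (M_tau1 : forall n, (1 <= n)%N -> tau1 (M n) < +oo)
  (k : nat) (k_ge1 : (1 <= k)%N)
  (mu nu : probability 'rV[R]_d R) (mu_P1 : P1 mu) (nu_P1 : P1 nu) :
  W1 (Phi G M k mu) (Phi G M k nu)
    <= tau1_gibbs eps (Gbar k.-1) (Gtil k.-1) (G k.-1) nu
       * tau1 (M k) * W1 mu nu.
Proof.
rewrite /Phi; move: (G_C1 k.-1) (G_gt k.-1) (G_le k.-1) (G_lip k.-1)
  (G_til k.-1) (M_tau1 k k_ge1).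
move: (G k.-1) (Gbar k.-1) (Gtil k.-1) (M k) => g A B N cG epsG GA Glip GB
  Ntau.
have G_ge x : (eps <= g x)%R by exact: ltW.
have {}GB z : (enorm z * enorm (grad g z) <= B)%R.
  by rewrite -lee_fin; apply: le_trans GB; apply: ereal_sup_ubound; exists z.
have [L L0 [LE GL]] := lip_normP g Glip.
(* Measures that agree on Borel sets are treated apart, since the sign of [tau1 N] is obtained from
   a distinct pair. *)
have [munu|munu] := pselect (measure_eq mu nu).
  rewrite !W1_eq0 ?mule0//; apply: kact_measure_eq.
  exact: (gibbs_measure_eq _ _ _ cG eps_gt0 G_ge GA).
have tau0 : 0 <= tau1 N by exact: tau1_ge0 munu.
have gmu : P1 (boltzmann_gibbs g mu).
  exact: (P1_gibbs _ _ _ cG eps_gt0 G_ge GA).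
have gnu : P1 (boltzmann_gibbs g nu).
  exact: (P1_gibbs _ _ _ cG eps_gt0 G_ge GA).
apply: le_trans (W1_kact_le _ _ _ gmu gnu Ntau) _.
rewrite [X in _ <= X * _]muleC -muleA lee_wpmul2l//.
have gibbs_le :=
  W1_gibbs_le _ _ _ _ _ cG eps_gt0 G_ge GA GB L0 GL mu nu nu_P1.
apply: le_trans gibbs_le _; rewrite lee_wpmul2r ?W1_ge0//.
rewrite /tau1_gibbs LE !inver !gt_eqF ?exprn_gt0// -!EFinM leeD2r//.
rewrite EFinM lee_wpmul2r ?lee_fin ?invr_ge0 ?(ltW eps_gt0)//.
(* The difference from [tau1_gibbs] is now [grad_sup g], nonnegative because it dominates the
   gradient norm at the origin. *)
rewrite -addeA EFinD leeDr//.
apply: (@le_trans _ _ (enorm (grad g 0%R))%:E).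
  by rewrite lee_fin enorm_ge0.
by apply: ereal_sup_ubound; exists 0%R.
Qed.
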